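(* Let $m$ be a positive integer and let $a_1,a_2,a_3,K$ be integers with $0\le a_1,a_2,a_3,K\le m-1$. Then $$S_m(\{a_1,a_2,a_3\},K)\le\left\lfloor\frac{m}{3}\right\rfloor.$$
   Context: For a positive integer $m$ and non-negative integers $a_1,a_2,a_3,K$ (the $a_i$ need not be distinct; $\{a_1,a_2,a_3\}$ is just a list of parameters), define $$\begin{aligned}S_m(\{a_1,a_2,a_3\},K)=\sum_{k=0}^K\Bigl(&\left\lfloor\tfrac{a_1+a_2+a_3+k}{m}\right\rfloor-\left\lfloor\tfrac{a_1+a_2+k}{m}\right\rfloor-\left\lfloor\tfrac{a_2+a_3+k}{m}\right\rfloor-\left\lfloor\tfrac{a_1+a_3+k}{m}\right\rfloor\\&+\left\lfloor\tfrac{a_1+k}{m}\right\rfloor+\left\lfloor\tfrac{a_2+k}{m}\right\rfloor+\left\lfloor\tfrac{a_3+k}{m}\right\rfloor-\left\lfloor\tfrac{k}{m}\right\rfloor\Bigr).\end{aligned}$$ *)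

(* Defs.v *)
From mathcomp Require Import all_boot all_order all_algebra.

Set Implicit Arguments.
Unset Strict Implicit.
Unset Printing Implicit Defensive.

Import Order.TTheory GRing.Theory Num.Theory.
Local Open Scope ring_scope.

Definition floor_frac (n m : nat) : int := Num.floor (n%:R / m%:R : rat).

(* The parameters are natural numbers, but the summand is a difference of
   floors and is formed in int, so no subtraction is truncated.
   The index k runs over 0, ..., K inclusive. *)
Definition S3 (m a1 a2 a3 K : nat) : int :=
  \sum_(0 <= k < K.+1)
    (floor_frac (a1 + a2 + a3 + k) m
     - floor_frac (a1 + a2 + k) m
     - floor_frac (a2 + a3 + k) m
     - floor_frac (a1 + a3 + k) m
     + floor_frac (a1 + k) m
     + floor_frac (a2 + k) m
     + floor_frac (a3 + k) m
     - floor_frac k m).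

(* Main.v *)
(* S_m is the third difference at 0, with steps a1, a2, a3, of
   F(x) = sum_(k < n) floor((x + k) / m), where n = K + 1 <= m. This F is
   piecewise linear: F(x) = max(0, x + n - m) on [0, m), and F(x + m) = F(x) + n.
   By symmetry a1 <= a2 <= a3, and 3 S_m <= m then splits into finitely many
   cases of linear arithmetic, according to the linear pieces that contain
   the arguments of F. *)
Require Import Defs.
From mathcomp Require Import all_boot all_order all_algebra zify.

Set Implicit Arguments.
Unset Strict Implicit.
Unset Printing Implicit Defensive.

Import Order.TTheory GRing.Theory Num.Theory.
Local Open Scope ring_scope.

Lemma floor_fracE (n m : nat) : (0 < m)%N -> floor_frac n m = (n %/ m)%N.
Proof.
move=> m_gt0; apply: Num.Theory.floor_def.
have m_gt0' : 0 < m%:R :> rat by rewrite ltr0n.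
rewrite ler_pdivlMr // ltr_pdivrMr // -[_ + 1]/((n %/ m)%:Z + 1%:Z) -PoszD.
by rewrite -!pmulrn -!natrM ler_nat ltr_nat leq_divM addn1 ltn_ceil.
Qed.

Definition div_sum (m n x : nat) : nat := (\sum_(0 <= k < n) (x + k) %/ m)%N.

(** Since [x + k < 2 * m], each quotient is 0 or 1, and it is 1 exactly for [k >= m - x]. The
    truncated subtraction plays the part of the maximum with 0. *)
Lemma div_sum_small (m n x : nat) : (n <= m)%N -> (x < m)%N ->
  div_sum m n x = (x + n - m)%N.
Proof.
move=> le_nm lt_xm; rewrite /div_sum; elim: n le_nm => [|n IHn] lt_nm.
  by rewrite big_geq //; lia.
rewrite big_nat_recr //= IHn; last exact: ltnW.
case: (leqP m (x + n)) => [le_m | lt_m]; last by rewrite divn_small //; lia.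
rewrite -[in (_ %/ _)%N](subnKC le_m) divnDl ?dvdnn // divnn divn_small; lia.
Qed.

Lemma div_sumD (m n x : nat) : (0 < m)%N ->
  div_sum m n (x + m) = (div_sum m n x + n)%N.
Proof.
move=> m_gt0; have sum1 : (\sum_(0 <= k < n) 1 = n)%N.
  by rewrite sum_nat_const_nat subn0 muln1.
rewrite /div_sum -[X in _ = (_ + X)%N]sum1 -big_split /=; apply: eq_bigr => k _.
by rewrite addnAC divnDr ?dvdnn // divnn m_gt0.
Qed.

(** Three periods suffice, because the arguments are sums of at most three numbers below [m]. The
    kink inside each period stays hidden in the truncated subtraction. *)
Lemma div_sum_cases (m n x : nat) : (n <= m)%N -> (0 < m)%N -> (x < 3 * m)%N ->
  [\/ (x < m)%N /\ div_sum m n x = (x + n - m)%N,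
      (m <= x < 2 * m)%N /\ div_sum m n x = (x - m + n - m + n)%N
    | (2 * m <= x)%N /\ div_sum m n x = (x - 2 * m + n - m + 2 * n)%N].
Proof.
move=> le_nm m_gt0 lt_x3m.
case: (ltnP x m) => [lt_xm | le_mx]; first by constructor 1; rewrite div_sum_small.
rewrite -(subnK le_mx) div_sumD //.
case: (ltnP x (2 * m)) => [lt_x2m | le_2mx].
  by constructor 2; rewrite div_sum_small; lia.
have le_mxm : (m <= x - m)%N by lia.
by constructor 3; rewrite -(subnK le_mxm) div_sumD // div_sum_small; lia.
Qed.

Lemma sum_floor_frac (m n x : nat) : (0 < m)%N ->
  \sum_(0 <= k < n) floor_frac (x + k) m = (div_sum m n x)%:Z.
Proof.
move=> m_gt0; rewrite /div_sum (big_morph Posz PoszD (erefl _)).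
by apply: eq_bigr => k _; rewrite floor_fracE.
Qed.

Lemma S3E (m a b c K : nat) : (K < m)%N ->
  S3 m a b c K =
    (div_sum m K.+1 (a + b + c))%:Z - (div_sum m K.+1 (a + b))%:Z
    - (div_sum m K.+1 (b + c))%:Z - (div_sum m K.+1 (a + c))%:Z
    + (div_sum m K.+1 a)%:Z + (div_sum m K.+1 b)%:Z + (div_sum m K.+1 c)%:Z.
Proof.
move=> lt_Km; have m_gt0 : (0 < m)%N := leq_ltn_trans (leq0n K) lt_Km.
have sum0 : \sum_(0 <= k < K.+1) floor_frac k m = 0.
  (* [K < m] unfolds to [K.+1 - m == 0], which is the value of [div_sum] at 0. *)
  by rewrite (sum_floor_frac K.+1 0 m_gt0) div_sum_small // (eqP lt_Km).
by rewrite /S3 !(sumrB, big_split) /= !sum_floor_frac // sum0 subr0.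
Qed.

(** This is [3 * S <= m] with the negative terms moved to the right, so that it can be stated in
    [nat]. Equality occurs at [a = b = c = n = m / 3] when 3 divides [m]. *)
Lemma div_sum_cube (m n a b c : nat) : (n <= m)%N ->
  (a <= b)%N -> (b <= c)%N -> (c < m)%N ->
  (3 * (div_sum m n (a + b + c) + div_sum m n a + div_sum m n b + div_sum m n c)
   <= m + 3 * (div_sum m n (a + b) + div_sum m n (b + c) + div_sum m n (a + c)))%N.
Proof.
move=> le_nm le_ab le_bc lt_cm; have m_gt0 : (0 < m)%N by lia.
rewrite (@div_sum_small m n a) ?(@div_sum_small m n b) ?(@div_sum_small m n c); try lia.
have /(div_sum_cases le_nm m_gt0) Hab : (a + b < 3 * m)%N by lia.
have /(div_sum_cases le_nm m_gt0) Hac : (a + c < 3 * m)%N by lia.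
have /(div_sum_cases le_nm m_gt0) Hbc : (b + c < 3 * m)%N by lia.
have /(div_sum_cases le_nm m_gt0) Habc : (a + b + c < 3 * m)%N by lia.
(* Impossible combinations of periods are discarded after each split, which limits the number of
   final calls to [lia]. *)
case: Hab => [[Hab ->]|[Hab ->]|[Hab ->]]; try (exfalso; lia);
case: Hac => [[Hac ->]|[Hac ->]|[Hac ->]]; try (exfalso; lia);
case: Hbc => [[Hbc ->]|[Hbc ->]|[Hbc ->]]; try (exfalso; lia);
case: Habc => [[Habc ->]|[Habc ->]|[Habc ->]]; try (exfalso; lia); lia.
Qed.

Theorem corollary14 (m a1 a2 a3 K : nat)
    (hm : (0 < m)%N)
    (ha1 : (a1 <= m - 1)%N) (ha2 : (a2 <= m - 1)%N) (ha3 : (a3 <= m - 1)%N)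
    (hK : (K <= m - 1)%N) :
  S3 m a1 a2 a3 K <= floor_frac m 3.
Proof.
have lt_Km : (K < m)%N by lia.
rewrite floor_fracE // S3E //.
wlog le12 : a1 a2 ha1 ha2 / (a1 <= a2)%N => [sorted|].
  case: (leqP a1 a2) => [|/ltnW] le; first exact: sorted.
  by have := sorted a2 a1 ha2 ha1 le; rewrite (addnC a2 a1); lia.
wlog le23 : a1 a2 a3 ha1 ha2 ha3 le12 / (a2 <= a3)%N => [sorted|].
  (* With [a1 <= a2] known, [a3] is inserted in one of three positions. *)
  case: (leqP a2 a3) => [|/ltnW le32]; first exact: sorted.
  case: (leqP a1 a3) => [le13|/ltnW le31].
    have := sorted a1 a3 a2 ha1 ha3 ha2 le13 le32.
    by rewrite (addnAC a1 a3 a2) (addnC a3 a2); lia.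
  have := sorted a3 a1 a2 ha3 ha1 ha2 le31 le12.
  by rewrite (addnC a3 a1) (addnC a3 a2) (addnAC a1 a3 a2); lia.
have lt_a3m : (a3 < m)%N by lia.
(* As the sum is an integer, [3 * S <= m] gives the bound by [m %/ 3]. *)
have := div_sum_cube lt_Km le12 le23 lt_a3m; lia.
Qed.
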